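(* Let $n\ge 1$ and consider the model $(B \text{ vs } ((R^1,A^1),\ldots,(R^n,A^n)))$, that is, the system $$\begin{cases}\dfrac{dB}{dt}=-\displaystyle\sum_{i=1}^n\Big[\alpha_d^i+(\alpha_c^i-\alpha_d^i)\dfrac{A^i}{A_0^i}\Big]R^i,\\[2mm] \dfrac{dR^i}{dt}=-p_i\,r_{R^i}\,B,\quad i=1,\ldots,n,\\[2mm] \dfrac{dA^j}{dt}=-p_{n+j}\,r_{A^j}\,B,\quad j=1,\ldots,n,\end{cases}$$ with initial values $B(0)=B_0$, $R^i(0)=R^i_0$, $A^j(0)=A^j_0$. Let the fire allocation $P$ of $B$ be sought in the set $$\mathcal P=\Big\{P=(p_1,\ldots,p_n,p_{n+1},\ldots,p_{2n}) : p_k\in[0,1]\text{ is constant for all }k=1,\ldots,2n,\ \sum_{k=1}^{2n}p_k=1\Big\}.$$ Define the threatening rates $$b_i=\alpha_c^i\,r_{R^i}\quad(i=1,\ldots,n),\qquad b_{n+j}=\frac{r_{A^j}(\alpha_c^j-\alpha_d^j)R_0^j}{A_0^j}\quad(j=1,\ldots,n).$$ Let $k\in\arg\max_{l=1,\ldots,2n} b_l$. Then the optimal fire allocation of $B$ is $$P^*=(0,\ldots,0,\underbrace{1}_{k},0,\ldots,0),$$ the vector with $1$ in position $k$ and $0$ elsewhere. That is, writing $B_P(t)$ for the $B$-component of the solution with allocation $P$, one has $B_{P^*}(t)\ge B_P(t)$ for every $P\in\mathcal P$ and every time $t\ge 0$ in the range of validity of the model.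
   Context: A Blue force $B$ fights a Red party consisting of $n$ armed forces $R^1,\ldots,R^n$, where $R^i$ is supported by a supply unit $A^i$. The functions $B(t),R^i(t),A^j(t)$ are the numbers of troops at time $t$. The constants are: $r_{R^i}>0$, the attrition rate of $B$ to $R^i$; $r_{A^j}>0$, the attrition rate of $B$ to $A^j$; $\alpha_c^i$ and $\alpha_d^i$, the fully-connected and fully-disconnected attrition rates of $R^i$ with $A^i$, with $0\le\alpha_d^i\le\alpha_c^i$. The initial values $B_0,R_0^i,A_0^j$ are positive. The fire allocation $P=(p_1,\ldots,p_{2n})$ gives the proportions of $B$'s fire directed at $R^1,\ldots,R^n$ (entries $p_1,\ldots,p_n$) and at $A^1,\ldots,A^n$ (entries $p_{n+1},\ldots,p_{2n}$). A fire allocation in $\mathcal P$ is optimal if it maximizes the remaining number of Blue troops $B(t)$ at any time $t$, among all allocations in $\mathcal P$ with the same parameters and initial values. When comparing two allocations, a time $t$ is in the range of validity of the model if, for both allocations, all the troop numbers $B,R^i,A^j$ given by the system are nonnegative on $[0,t]$ (the numbers of troops are nonnegative, and an agent's impact stops once its number of troops is reduced to zero). *)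

(* Defs.v *)
From HB Require Import structures.
From mathcomp Require Import all_boot all_order all_algebra.
From mathcomp Require Import all_classical all_reals all_analysis.

Set Implicit Arguments.
Unset Strict Implicit.
Unset Printing Implicit Defensive.

Import Order.TTheory GRing.Theory Num.Theory.
Import numFieldNormedType.Exports.

Local Open Scope classical_set_scope.
Local Open Scope ring_scope.

(* Superscript i of a force R^i or a supply unit A^i ranges over 'I_n. *)
Record model (K : realType) (n : nat) := Model {
  rR : 'I_n -> K;        (* attrition rate of B to R^i *)
  rA : 'I_n -> K;        (* attrition rate of B to A^j *)
  alphac : 'I_n -> K;    (* fully-connected attrition rate of R^i with A^i *)
  alphad : 'I_n -> K;    (* fully-disconnected attrition rate of R^i with A^i *)
  B0 : K;
  R0 : 'I_n -> K;
  A0 : 'I_n -> K;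
  rR_gt0 : forall i, 0 < rR i;
  rA_gt0 : forall j, 0 < rA j;
  alphad_ge0 : forall i, 0 <= alphad i;
  alphad_le_alphac : forall i, alphad i <= alphac i;
  B0_gt0 : 0 < B0;
  R0_gt0 : forall i, 0 < R0 i;
  A0_gt0 : forall j, 0 < A0 j
}.

Record troops (K : realType) (n : nat) := Troops {
  tB : K -> K;
  tR : 'I_n -> K -> K;
  tA : 'I_n -> K -> K
}.

(* An allocation is a row vector of length n + n: entry lshift n i is the
   share of fire on R^i, entry rshift n j the share on A^j. *)
Definition allocations (K : realType) (n : nat) : set 'rV[K]_(n + n) :=
  [set P | (forall k, 0 <= P 0 k <= 1) /\ \sum_k P 0 k = 1].
Arguments allocations : clear implicits.

(* Solutions are only required on [0, T], since for some allocations the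
   quadratic system blows up in finite time after troop numbers have become
   negative. Continuity on [0, T] with the equations on ]0, T[ is equivalent
   to the equations on [0, T] with one-sided derivatives at the endpoints. *)
Definition solution (K : realType) (n : nat) (M : model K n)
    (P : 'rV[K]_(n + n)) (T : K) (x : troops K n) : Prop :=
  [/\ [/\ tB x 0 = B0 M,
          forall i, tR x i 0 = R0 M i
        & forall j, tA x j 0 = A0 M j],
      [/\ {within `[0, T], continuous (tB x)},
          forall i, {within `[0, T], continuous (tR x i)}
        & forall j, {within `[0, T], continuous (tA x j)}]
    & forall t : K, t \in `]0, T[ ->
      [/\ is_derive t 1 (tB x)
            (- \sum_i (alphad M i
                       + (alphac M i - alphad M i) * (tA x i t / A0 M i))
                      * tR x i t),
          forall i, is_derive t 1 (tR x i)
            (- (P 0 (lshift n i) * rR M i * tB x t))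
        & forall j, is_derive t 1 (tA x j)
            (- (P 0 (rshift n j) * rA M j * tB x t))]].

Definition nonneg_on (K : realType) (n : nat) (T : K) (x : troops K n) : Prop :=
  forall t : K, t \in `[0, T] ->
    [/\ 0 <= tB x t, forall i, 0 <= tR x i t & forall j, 0 <= tA x j t].

(* The hypotheses on x and y say that T is in the range of validity of the
   model for the comparison of P with Q. *)
Definition optimal (K : realType) (n : nat) (M : model K n)
    (P : 'rV[K]_(n + n)) : Prop :=
  allocations K n P /\
  forall Q, allocations K n Q -> forall T : K, 0 <= T ->
  forall x y : troops K n,
    solution M P T x -> nonneg_on T x ->
    solution M Q T y -> nonneg_on T y ->
    tB y T <= tB x T.

Definition threatening_rate (K : realType) (n : nat) (M : model K n) :
    'rV[K]_(n + n) :=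
  row_mx (\row_i (alphac M i * rR M i))
         (\row_j (rA M j * (alphac M j - alphad M j) * R0 M j / A0 M j)).

(* Main.v *)
Require Import Defs.
From mathcomp Require Import all_boot all_order all_algebra.
From mathcomp Require Import all_classical all_reals all_analysis.
From mathcomp Require Import ring lra.

Set Implicit Arguments.
Unset Strict Implicit.
Unset Printing Implicit Defensive.

Import Order.TTheory GRing.Theory Num.Theory.
Import numFieldNormedType.Exports.

Local Open Scope classical_set_scope.
Local Open Scope ring_scope.

(** The idea is to measure time by the cumulative firepower of Blue,
    [S t], the integral of [B] over [[0, t]]. Every Red troop number is affine
    in [S], so [B] obeys the autonomous second-order equation
      [S'' = - fire (S)],
    where, with [b] the vector of threatening rates,
      [fire (S) = F0 - (\sum_l p_l b_l) S + q_P S^2]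
    (lemma [fire_depleted]). The constant [F0] does not depend on the
    allocation, [q_P >= 0], and [q_P = 0] when all the fire goes to one target.
    As [\sum_l p_l b_l] is an average of the rates [b_l], it is at most
    [b_k = max b], so for [S >= 0] the fire that Blue receives under any
    allocation is at least [F0 - b_k S], with equality for the allocation
    concentrated on [k].

    If [S_x] belongs to that allocation and [S_y] to another one, then
    [D = S_x - S_y] satisfies [D'' >= b_k D] and [D 0 = D' 0 = 0]. Since
    [b_k >= 0], one can write [D'' - b_k D = (d/dt + w) (D' - w D)] with
    [w = sqrt b_k], and two applications of a first-order comparison principle
    ([deriv_on_ge0]) give [D' - w D >= 0], then [D >= 0], hence [D' >= 0]
    ([second_order_comparison]). But [D' = B_x - B_y]. *)

(** * Differentiation on a closed interval *)

Section DerivOn.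
Context {K : realType}.
Implicit Types (f g : K -> K) (a c t T : K).

(** Derivatives are required in the open interval only: this is what solutions
    provide, and what the mean value theorem needs. *)
Definition deriv_on T f f' : Prop :=
  {within `[0, T], continuous f} /\
  (forall t, t \in `]0, T[ -> is_derive t 1 f (f' t)).

Lemma deriv_on_eq T f f' g' :
  (forall t, t \in `]0, T[ -> f' t = g' t) -> deriv_on T f f' ->
  deriv_on T f g'.
Proof. by move=> fg [cf df]; split=> // t tT; rewrite -fg //; exact: df. Qed.

Lemma deriv_on_cst T c : deriv_on T (cst c) (cst 0).
Proof.
split=> [|t _]; last exact: is_derive_cst.
by apply: continuous_subspaceT => t; exact: cvg_cst.
Qed.

Lemma deriv_onD T f f' g g' : deriv_on T f f' -> deriv_on T g g' ->
  deriv_on T (fun t => f t + g t) (fun t => f' t + g' t).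
Proof.
move=> [cf df] [cg dg]; split=> [t|t tT].
  by apply: cvgD; [exact: cf|exact: cg].
by apply: is_deriveD; [exact: df|exact: dg].
Qed.

Lemma deriv_onM T f f' g g' : deriv_on T f f' -> deriv_on T g g' ->
  deriv_on T (fun t => f t * g t) (fun t => f' t * g t + f t * g' t).
Proof.
move=> [cf df] [cg dg]; split=> [t|t tT].
  by apply: cvgM; [exact: cf|exact: cg].
have := df _ tT => ?; have := dg _ tT => ?.
by apply: is_derive_eq; rewrite addrC /GRing.scale /= [g t * _]mulrC.
Qed.

Lemma deriv_onZ T c f f' : deriv_on T f f' ->
  deriv_on T (fun t => c * f t) (fun t => c * f' t).
Proof.
move=> df; apply: (deriv_on_eq _ (deriv_onM (deriv_on_cst T c) df)) => t _ /=.
by rewrite mul0r add0r.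
Qed.

Lemma deriv_onB T f f' g g' : deriv_on T f f' -> deriv_on T g g' ->
  deriv_on T (fun t => f t - g t) (fun t => f' t - g' t).
Proof.
move=> df /(deriv_onZ (-1)) /(deriv_onD df).
rewrite (_ : (fun t => f t + -1 * g t) = fun t => f t - g t); last first.
  by apply/funext => t; rewrite mulN1r.
by apply: deriv_on_eq => t _; rewrite mulN1r.
Qed.

Lemma deriv_on_sum T n (f f' : 'I_n -> K -> K) :
  (forall i, deriv_on T (f i) (f' i)) ->
  deriv_on T (fun t => \sum_i f i t) (fun t => \sum_i f' i t).
Proof.
move=> df; rewrite /index_enum.
elim: (Finite.enum _) => [|i s IHs].
  rewrite (_ : (fun t => _) = cst 0); last by apply/funext => t; rewrite big_nil.
  by apply: deriv_on_eq (deriv_on_cst T 0) => t _; rewrite big_nil.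
rewrite (_ : (fun t => _) = fun t => f i t + \sum_(j <- s) f j t); last first.
  by apply/funext => t; rewrite big_cons.
apply: deriv_on_eq (deriv_onD (df i) IHs) => t _.
by rewrite big_cons.
Qed.

Lemma deriv_on_expR T c :
  deriv_on T (fun t => expR (c * t)) (fun t => c * expR (c * t)).
Proof.
have d t : is_derive t 1 (fun t : K => expR (c * t)) (c * expR (c * t)).
  have dc : is_derive t 1 (fun s : K => c * s) c.
    have -> : (fun s : K => c * s) = c \*: id by [].
    by apply: is_derive_eq; rewrite /GRing.scale /= mulr1.
  by rewrite mulrC; apply: (is_derive1_comp (is_derive_expR _) dc).
split=> [|t _]; last exact: d.
apply: continuous_subspaceT => t.
by apply: differentiable_continuous; apply/derivable1_diffP.
Qed.

Lemma deriv_on_nondecreasing T f f' : deriv_on T f f' ->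
  (forall t, t \in `]0, T[ -> 0 <= f' t) ->
  forall t, t \in `[0, T] -> f 0 <= f t.
Proof.
move=> [cf df] f'_ge0 t; rewrite in_itv /= => /andP[].
rewrite le_eqVlt => /predU1P[<- //|t_gt0 tT].
have sub s : s \in `]0, t[ -> s \in `]0, T[.
  rewrite !in_itv /= => /andP[-> /= st]; exact: lt_le_trans st tT.
have [||s s0t] := @MVT K f f' 0 t t_gt0.
- by move=> s /sub; exact: df.
- apply: continuous_subspaceW cf => s /=; rewrite !in_itv /= => /andP[-> /= st].
  exact: le_trans st tT.
rewrite subr0 => fE; rewrite -subr_ge0 fE mulr_ge0 ?(ltW t_gt0) //.
exact/f'_ge0/sub.
Qed.

Lemma deriv_on_eq0 T f f' : deriv_on T f f' ->
  (forall t, t \in `]0, T[ -> f' t = 0) ->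
  forall t, t \in `[0, T] -> f t = f 0.
Proof.
move=> df f'0 t tT; apply/le_anti/andP; split; last first.
  by apply: (deriv_on_nondecreasing df) tT => s /f'0 ->.
have := deriv_on_nondecreasing (deriv_onZ (-1) df) _ tT.
by rewrite !mulN1r lerN2; apply=> s /f'0 ->; rewrite mulr0.
Qed.

(** The integrating factor [expR (- c t)] makes [expR (- c t) * f t]
    nondecreasing. *)
Lemma deriv_on_ge0 T c f f' : deriv_on T f f' -> 0 <= f 0 ->
  (forall t, t \in `]0, T[ -> c * f t <= f' t) ->
  forall t, t \in `[0, T] -> 0 <= f t.
Proof.
move=> df f0 f'_ge t tT.
have := deriv_on_nondecreasing (deriv_onM (deriv_on_expR T (- c)) df) _ tT.
rewrite mulr0 expR0 mul1r => le_f.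
rewrite -(pmulr_rge0 _ (expR_gt0 (- c * t))); apply: le_trans f0 _.
apply: le_f => s sT.
have -> : - c * expR (- c * s) * f s + expR (- c * s) * f' s =
          expR (- c * s) * (f' s - c * f s) by ring.
by rewrite mulr_ge0 ?expR_ge0 // subr_ge0 f'_ge.
Qed.

(** Two first-order comparisons, from the factorization
    [D'' - b D = (d/dt + w) (D' - w D)] where [w = sqrt b]. *)
Lemma second_order_comparison T b D D' D'' : 0 <= b ->
  deriv_on T D D' -> deriv_on T D' D'' -> D 0 = 0 -> D' 0 = 0 ->
  (forall t, t \in `]0, T[ -> b * D t <= D'' t) ->
  forall t, t \in `[0, T] -> 0 <= D' t.
Proof.
move=> b_ge0 dD dD' D0 D'0 D''_ge.
set w := Num.sqrt b; have wK : b = w * w by rewrite -expr2 sqr_sqrtr.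
have D'_ge t : t \in `[0, T] -> w * D t <= D' t.
  move=> tT; rewrite -subr_ge0.
  apply: (deriv_on_ge0 (c := - w) (deriv_onB dD' (deriv_onZ w dD))) tT.
    by rewrite D0 D'0 mulr0 subr0.
  move=> s /D''_ge; rewrite wK => ?; lra.
have D_ge0 t : t \in `[0, T] -> 0 <= D t.
  apply: (deriv_on_ge0 (c := w) dD); first by rewrite D0.
  by move=> s /subset_itv_oo_cc /D'_ge.
by move=> t tT; apply: le_trans (D'_ge _ tT); rewrite mulr_ge0 ?sqrtr_ge0 ?D_ge0.
Qed.

End DerivOn.

(** * The fire received by Blue as a function of its cumulative firepower *)

Section Fire.
Context {K : realType} {n : nat} (M : model K n).
Implicit Types (P : 'rV[K]_(n + n)) (x : troops K n) (S : K).

Definition fire (R A : 'I_n -> K) : K :=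
  \sum_i (alphad M i + (alphac M i - alphad M i) * (A i / A0 M i)) * R i.

Definition depleted_fire P S : K :=
  fire (fun i => R0 M i - P 0 (lshift n i) * rR M i * S)
       (fun j => A0 M j - P 0 (rshift n j) * rA M j * S).

Definition synergy P : K :=
  \sum_i (alphac M i - alphad M i) * rR M i * rA M i / A0 M i *
         (P 0 (lshift n i) * P 0 (rshift n i)).

(** The linear coefficient is where the threatening rates come from: [b_i] is
    the rate at which fire on [R^i] reduces the damage done to Blue, [b_{n+j}]
    the rate at which fire on [A^j] does. Splitting the fire between [R^i] and
    its support [A^i] is wasteful, whence the nonnegative quadratic term. *)
Lemma fire_depleted P S :
  depleted_fire P S =
  \sum_i alphac M i * R0 M i
  - (\sum_l P 0 l * threatening_rate M 0 l) * S + synergy P * S ^+ 2.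
Proof.
rewrite /depleted_fire /fire /synergy big_split_ord /= -big_split !mulr_suml.
rewrite -sumrN -!big_split /=; apply: eq_bigr => i _.
rewrite /threatening_rate row_mxEl row_mxEr !mxE.
have := A0_gt0 M i => A_gt0; field; exact: lt0r_neq0.
Qed.

Lemma synergy_ge0 P : allocations K n P -> 0 <= synergy P.
Proof.
move=> [P01 _]; apply: sumr_ge0 => i _.
have P_ge0 l : 0 <= P 0 l by case/andP: (P01 l).
apply: mulr_ge0; last by rewrite mulr_ge0.
rewrite divr_ge0 ?(ltW (A0_gt0 _ _)) // !mulr_ge0 ?(ltW (rR_gt0 _ _)) //.
  by rewrite subr_ge0 alphad_le_alphac.
exact/ltW/rA_gt0.
Qed.

Lemma threatening_rate_ge0 l : 0 <= threatening_rate M 0 l.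
Proof.
rewrite /threatening_rate -(splitK l); case: (fintype.split l) => i /=.
  rewrite row_mxEl mxE mulr_ge0 ?(ltW (rR_gt0 _ _)) //.
  exact: le_trans (alphad_ge0 _ _) (alphad_le_alphac _ _).
rewrite row_mxEr mxE divr_ge0 ?(ltW (A0_gt0 _ _)) // mulr_ge0 ?(ltW (R0_gt0 _ _)) //.
by rewrite mulr_ge0 ?(ltW (rA_gt0 _ _)) // subr_ge0 alphad_le_alphac.
Qed.

Lemma allocation_delta k : allocations K n (delta_mx 0 k).
Proof.
split=> [l|]; first by rewrite mxE eqxx /=; case: eqP; rewrite /= !(lexx, ler01).
rewrite (bigD1 k) //= big1 => [|l /negPf lk]; first by rewrite mxE !eqxx addr0.
by rewrite mxE lk andbF.
Qed.

(** [R^i] and [A^i] are different targets, so a concentrated allocation has no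
    quadratic term. *)
Lemma fire_depleted_delta k S :
  depleted_fire (delta_mx 0 k) S =
  \sum_i alphac M i * R0 M i - threatening_rate M 0 k * S.
Proof.
rewrite fire_depleted [synergy _]big1 => [|i _]; last first.
  rewrite !mxE eqxx /=; case: (eqVneq _ k) => [<-|_]; last by rewrite mul0r mulr0.
  by rewrite eq_rlshift !mulr0.
rewrite mul0r addr0; congr (_ - _ * _).
rewrite (bigD1 k) //= big1 => [|l /negPf lk]; last first.
  by rewrite mxE lk andbF mul0r.
by rewrite mxE !eqxx mul1r addr0.
Qed.

Lemma fire_depleted_ge P k S :
  (forall l, threatening_rate M 0 l <= threatening_rate M 0 k) ->
  allocations K n P -> 0 <= S ->
  \sum_i alphac M i * R0 M i - threatening_rate M 0 k * S <= depleted_fire P S.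
Proof.
move=> kmax PP S_ge0; rewrite fire_depleted.
have avg : \sum_l P 0 l * threatening_rate M 0 l <= threatening_rate M 0 k.
  case: PP => P01 P1; rewrite -[leRHS]mul1r -P1 mulr_suml ler_sum // => l _.
  by rewrite ler_wpM2l //; case/andP: (P01 l).
rewrite -addrA lerD2l -lerBlDl opprK.
apply: le_trans (mulr_ge0 (synergy_ge0 PP) (sqr_ge0 S)).
by rewrite addrC -mulrBl mulr_le0_ge0 // subr_le0.
Qed.

(** * Cumulative firepower of a solution *)

(** The integral of [tB x] over [[0, t]], when [x] is a solution: each summand
    is the share of the firepower spent on one target, as read off its losses,
    and the shares of an allocation add up to 1. *)
Definition firepower x (t : K) : K :=
  \sum_i (rR M i)^-1 * (R0 M i - tR x i t) +
  \sum_j (rA M j)^-1 * (A0 M j - tA x j t).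

Section Solution.
Context {P : 'rV[K]_(n + n)} {T : K} {x : troops K n}.
Hypotheses (alloc_P : allocations K n P) (sol_x : solution M P T x).

Lemma deriv_on_tB : deriv_on T (tB x) (fun t => - fire (tR x ^~ t) (tA x ^~ t)).
Proof. by case: sol_x => _ [cB _ _] d; split=> // t /d[]. Qed.

Lemma deriv_on_tR i :
  deriv_on T (tR x i) (fun t => - (P 0 (lshift n i) * rR M i * tB x t)).
Proof. by case: sol_x => _ [_ cR _] d; split=> // t /d[]. Qed.

Lemma deriv_on_tA j :
  deriv_on T (tA x j) (fun t => - (P 0 (rshift n j) * rA M j * tB x t)).
Proof. by case: sol_x => _ [_ _ cA] d; split=> // t /d[]. Qed.

Lemma deriv_on_firepower : deriv_on T (firepower x) (tB x).
Proof.
have dR i := deriv_onZ (rR M i)^-1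
  (deriv_onB (deriv_on_cst T (R0 M i)) (deriv_on_tR i)).
have dA j := deriv_onZ (rA M j)^-1
  (deriv_onB (deriv_on_cst T (A0 M j)) (deriv_on_tA j)).
apply: deriv_on_eq (deriv_onD (deriv_on_sum dR) (deriv_on_sum dA)) => t _ /=.
case: alloc_P => _ P1; rewrite -[RHS]mul1r -P1 big_split_ord /= mulrDl !mulr_suml.
by congr (_ + _); apply: eq_bigr => i _; rewrite sub0r opprK;
  rewrite [P _ _ * _]mulrC !mulrA mulVf ?mul1r // lt0r_neq0 ?rR_gt0 ?rA_gt0.
Qed.

Lemma firepower0 : firepower x 0 = 0.
Proof.
case: sol_x => [[_ R0E A0E] _ _].
by rewrite /firepower !big1 ?addr0 // => i _; rewrite ?R0E ?A0E subrr mulr0.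
Qed.

(** [f + c * firepower] has zero derivative. *)
Lemma depletion (f : K -> K) c : deriv_on T f (fun t => - (c * tB x t)) ->
  forall t, t \in `[0, T] -> f t = f 0 - c * firepower x t.
Proof.
move=> df t tT.
have := deriv_on_eq0 (deriv_onD df (deriv_onZ c deriv_on_firepower)) _ tT.
rewrite firepower0 mulr0 addr0 => <-; first by rewrite addrK.
by move=> s _; rewrite addNr.
Qed.

Lemma deriv_on_tB_depleted :
  deriv_on T (tB x) (fun t => - depleted_fire P (firepower x t)).
Proof.
apply: deriv_on_eq deriv_on_tB => t /subset_itv_oo_cc tT; congr (- _).
case: sol_x => [[_ R0E A0E] _ _]; apply: eq_bigr => i _.
by rewrite (depletion (deriv_on_tR i) tT) (depletion (deriv_on_tA i) tT) R0E A0E.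
Qed.

Lemma firepower_ge0 : nonneg_on T x ->
  forall t, t \in `[0, T] -> 0 <= firepower x t.
Proof.
move=> x_ge0 t tT; rewrite -firepower0.
apply: (deriv_on_nondecreasing deriv_on_firepower) tT => s.
by move=> /subset_itv_oo_cc /x_ge0[].
Qed.

End Solution.
End Fire.

(** * Optimality of the concentrated allocation *)

Theorem theorem1 (K : realType) (n : nat) (n_ge1 : (1 <= n)%N) (M : model K n)
    (k : 'I_(n + n))
    (k_argmax : forall l : 'I_(n + n),
      threatening_rate M 0 l <= threatening_rate M 0 k) :
  optimal M (delta_mx 0 k).
Proof.
have Pk := @allocation_delta K n k; split=> // Q PQ T T_ge0 x y sx _ sy y_ge0.
rewrite -subr_ge0.
apply: (second_order_comparison (threatening_rate_ge0 M k)
  (deriv_onB (deriv_on_firepower Pk sx) (deriv_on_firepower PQ sy))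
  (deriv_onB (deriv_on_tB_depleted Pk sx) (deriv_on_tB_depleted PQ sy))).
- by rewrite (firepower0 sx) (firepower0 sy) subrr.
- by case: sx sy => [[-> _ _] _ _] [[-> _ _] _ _]; rewrite subrr.
- move=> t /subset_itv_oo_cc tT; rewrite fire_depleted_delta.
  have := fire_depleted_ge k_argmax PQ (firepower_ge0 PQ sy y_ge0 tT).
  lra.
- by rewrite in_itv /= T_ge0 lexx.
Qed.
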